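(* On the boundary component $\mathcal A_\infty$, with coordinates $(q,P^1)$, where the restricted Hamiltonian vector field of the fifth Painlevé equation is $$X^V_{\mathcal A_\infty}(q,P^1)=-q(q-1)(2P^1+1)\,\partial_q-(q+1)P^1(P^1+1)\,\partial_{P^1},$$ a first integral of the isomonodromic foliation is given by $$\frac{qP^1(P^1+1)}{(q-1)^2}.$$
   Context: Put $\rho=\frac{(\kappa_0+\kappa_1-1)^2-\kappa_\infty^2}{4}$ for $\kappa_0,\kappa_1,\kappa_\infty\in\mathbb C$. The Hamiltonian vector field of the fifth Painlevé equation is $X^V=\partial_t+\frac{\partial H^V}{\partial p}\partial_q-\frac{\partial H^V}{\partial q}\partial_p$ with $$H^V=\frac{q(q-1)^2p^2-\big(\kappa_0(q-1)^2+(\kappa_1-1)q(q-1)-tq\big)p+\rho(q-1)}{t}.$$ Its integral curves are the leaves of the isomonodromic foliation. Coordinates: $r=\frac{1}{qt}$, $P^1=\frac{p(q-1)^2}{t}$. The component $\mathcal A_\infty$ corresponds to $t=\infty$ and is $\{r=0\}$ in the coordinates $(r,q,P^1)$; the restricted vector field is the limit as $r\to0$ of $-(q-1)X^V$ written in these coordinates. A first integral is a non-constant function annihilated by the vector field. *)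

(* Defs.v *)
From HB Require Import structures.
From mathcomp Require Import all_boot all_order all_algebra.
From mathcomp Require Import complex.
From mathcomp Require Import all_classical all_reals all_analysis.
From mathcomp Require Import ring.

Set Implicit Arguments.
Unset Strict Implicit.
Unset Printing Implicit Defensive.

Import Order.TTheory GRing.Theory Num.Theory.
Import numFieldNormedType.Exports.

Local Open Scope classical_set_scope.
Local Open Scope ring_scope.

(* Naming R[i] as a numFieldType gives it the norm, the topology and the
   (complex) differential calculus that MathComp-Analysis attaches to any
   numFieldType. *)
Definition Cplx (R : realType) : numFieldType := R[i].

Section VectorFields.
Variables (K : numFieldType) (V : normedModType K).

(* The vector field X = \sum_j X_j \partial_j acting on a function. *)
Definition lie_derivative (W : normedModType K) (X : V -> V) (f : V -> W)
    (x : V) : W :=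
  'D_(X x) f x.

Definition first_integral (U : set V) (X : V -> V) (f : V -> K) : Prop :=
  [/\ forall x, U x -> differentiable f x,
      forall x, U x -> lie_derivative X f x = 0 &
      exists x y, [/\ U x, U y & f x <> f y]].

End VectorFields.

Section PainleveV.
Variable R : realType.
Local Notation C := (Cplx R).

Section Hamiltonian.
Variables k0 k1 koo : C.

Definition rho : C := ((k0 + k1 - 1) ^+ 2 - koo ^+ 2) / 4.

(* Points of the original phase space are triples (t, q, p). *)
Definition HV (x : C * C * C) : C :=
  let t := x.1.1 in let q := x.1.2 in let p := x.2 in
  (q * (q - 1) ^+ 2 * p ^+ 2
   - (k0 * (q - 1) ^+ 2 + (k1 - 1) * q * (q - 1) - t * q) * p
   + rho * (q - 1)) / t.

Definition XV (x : C * C * C) : C * C * C :=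
  (1, 'D_(0, 0, 1) HV x, - 'D_(0, 1, 0) HV x).

End Hamiltonian.

(* (t, q, p) |-> (r, q, P^1) *)
Definition to_chart (x : C * C * C) : C * C * C :=
  let t := x.1.1 in let q := x.1.2 in let p := x.2 in
  ((q * t)^-1, q, p * (q - 1) ^+ 2 / t).

(* (r, q, P^1) |-> (t, q, p) *)
Definition of_chart (y : C * C * C) : C * C * C :=
  let r := y.1.1 in let q := y.1.2 in let P := y.2 in
  let t := (q * r)^-1 in
  (t, q, P * t / (q - 1) ^+ 2).

(* The part of (r, q, P^1)-space on which [of_chart] is regular. *)
Definition chart_domain : set (C * C * C) :=
  [set y | [/\ y.1.1 != 0, y.1.2 != 0 & y.1.2 != 1]].

Lemma of_chartK (y : C * C * C) :
  chart_domain y -> to_chart (of_chart y) = y.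
Proof.
case: y => [[r q] P] [/= r0 q0 q1].
have q10 : q - 1 != 0 by rewrite subr_eq0.
rewrite /to_chart /of_chart /=; congr (_, _, _); field.
- by rewrite q0 r0.
- by rewrite q10 q0 r0.
Qed.

(* A vector field transported to the coordinates (r, q, P^1): its components
   are the derivatives of the coordinate functions r, q, P^1 along X. *)
Definition in_chart (X : C * C * C -> C * C * C) (y : C * C * C) :
    C * C * C :=
  lie_derivative X to_chart (of_chart y).

(* [Y] is the restriction to {r = 0} of the vector field [Z] on
   (r, q, P^1)-space. The limit is taken within [chart_domain], jointly at every
   point (0, q, P^1): this contains the limit r -> 0 at fixed q, P^1 when
   q <> 0, 1, and it also determines [Y] on the lines q = 0 and q = 1, where Z
   is only defined by continuation. The r-component has limit 0, so that Z is
   tangent to {r = 0}. *)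
Definition restricts_to (Z : C * C * C -> C * C * C) (Y : C * C -> C * C) :
    Prop :=
  forall q P : C,
    Z @ within chart_domain (nbhs (0 : C, q, P)) -->
      (0 : C, (Y (q, P)).1, (Y (q, P)).2).

(* Points of A_oo are pairs (q, P^1). *)
Definition XV_Aoo (z : C * C) : C * C :=
  let q := z.1 in let P := z.2 in
  (- q * (q - 1) * (2 * P + 1), - (q + 1) * P * (P + 1)).

Definition integral_Aoo (z : C * C) : C :=
  let q := z.1 in let P := z.2 in
  q * P * (P + 1) / (q - 1) ^+ 2.

End PainleveV.

(* Main.v *)
Require Import Defs.
From mathcomp Require Import all_boot all_order all_algebra.
From mathcomp Require Import complex.
From mathcomp Require Import all_classical all_reals all_analysis.
From mathcomp Require Import ring.
Import GRing.Theory Num.Theory.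
Import numFieldNormedType.Exports.
Local Open Scope classical_set_scope.
Local Open Scope ring_scope.

(** In the coordinates (r, q, P^1) the components of [-(q-1) X^V] are polynomials
    (the poles of X^V in t and of the chart cancel), so its restriction to r = 0
    is their value there. *)

(** Substituting t = 1/(qr) and p = Pt/(q-1)^2 turns the rescaled field into the polynomial field
    [chart_XV] ([in_chart_XVE]). There every parameter carries a factor r, so by continuity
    ([continuous_chart_XV]) the limit at r = 0 is free of them. Writing F = qP(P+1)/(q-1)^2, with
    gradient given by [is_diff_integral], the limit field is (q-1)^3 (-F_P, F_q): up to a factor it
    is the Hamiltonian field of F, hence annihilates F. *)

Section PointwiseDiff.
Set Implicit Arguments.
Unset Strict Implicit.
Variables (K : numFieldType) (V : normedModType K).
Implicit Types (f g df dg : V -> K) (x : V).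

(** This and the following rules keep functions and differentials as explicit abstractions, so that
    they chain syntactically and yield expressions that [field] can compare. *)
Lemma is_diff_cstf (c : K) x : is_diff x (fun=> c) (fun=> 0).
Proof. exact: is_diff_cst. Qed.

Lemma is_diff_add f g df dg x : is_diff x f df -> is_diff x g dg ->
  is_diff x (fun y => f y + g y) (fun v => df v + dg v).
Proof. exact: is_diffD. Qed.

Lemma is_diff_opp f df x : is_diff x f df ->
  is_diff x (fun y => - f y) (fun v => - df v).
Proof. exact: is_diffN. Qed.

Lemma is_diff_mul f g df dg x : is_diff x f df -> is_diff x g dg ->
  is_diff x (fun y => f y * g y) (fun v => f x * dg v + g x * df v).
Proof. exact: is_diffM. Qed.

Lemma is_diff_exp f df n x : is_diff x f df ->
  is_diff x (fun y => f y ^+ n.+1) (fun v => n.+1%:R * f x ^+ n * df v).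
Proof. by move=> dfx; have := is_diffX n dfx; rewrite exprfctE. Qed.

Lemma is_diff_inv f df x : is_diff x f df -> f x != 0 ->
  is_diff x (fun y => (f y)^-1) (fun v => - (f x) ^- 2 * df v).
Proof.
move=> dfx fx0; apply: DiffDef; first exact: differentiableV.
by rewrite diffV// diff_val.
Qed.

End PointwiseDiff.

Section Projections.
Set Implicit Arguments.
Unset Strict Implicit.
Variables (K : numFieldType) (U V W : normedModType K).

Lemma is_diff_fst (f df : U -> V * W) x : is_diff x f df ->
  is_diff x (fun y => (f y).1) (fun v => (df v).1).
Proof.
move=> dfx; apply: (@is_diff_comp _ _ _ _ f df fst fst).
have cf : continuous (fst : V * W -> V) by move=> ?; exact: cvg_fst.
by apply: DiffDef; [exact: linear_differentiable | rewrite diff_lin].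
Qed.

Lemma is_diff_snd (f df : U -> V * W) x : is_diff x f df ->
  is_diff x (fun y => (f y).2) (fun v => (df v).2).
Proof.
move=> dfx; apply: (@is_diff_comp _ _ _ _ f df snd snd).
have cf : continuous (snd : V * W -> W) by move=> ?; exact: cvg_snd.
by apply: DiffDef; [exact: linear_differentiable | rewrite diff_lin].
Qed.

Lemma is_diff_derive (f df : U -> V) x v : is_diff x f df -> 'D_v f x = df v.
Proof. by move=> dfx; rewrite deriveE// diff_val. Qed.

Lemma is_diff_continuous (f df : U -> V) x :
  is_diff x f df -> {for x, continuous f}.
Proof. by move=> [dfx _]; exact: differentiable_continuous. Qed.

End Projections.

(* [notypeclasses] keeps the library's [is_diff] instances from solving the
   premises, with differentials that are not in pointwise form. *)
Ltac diff_rules :=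
  lazymatch goal with
  | |- is_diff_def _ (fun y => y) _ => exact: is_diff_id
  | |- is_diff_def _ (fun y => @?f y + @?g y) _ =>
      notypeclasses refine (@is_diff_add _ _ f g _ _ _ _ _); diff_rules
  | |- is_diff_def _ (fun y => - @?f y) _ =>
      notypeclasses refine (@is_diff_opp _ _ f _ _ _); diff_rules
  | |- is_diff_def _ (fun y => @?f y * @?g y) _ =>
      notypeclasses refine (@is_diff_mul _ _ f g _ _ _ _ _); diff_rules
  | |- is_diff_def _ (fun y => @?f y ^+ _) _ =>
      notypeclasses refine (@is_diff_exp _ _ f _ _ _ _); diff_rules
  | |- is_diff_def _ (fun y => (@?f y)^-1) _ =>
      notypeclasses refine (@is_diff_inv _ _ f _ _ _ _); [diff_rules|]
  | |- is_diff_def _ (fun y => (@?f y).1) _ =>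
      notypeclasses refine (@is_diff_fst _ _ _ _ f _ _ _); diff_rules
  | |- is_diff_def _ (fun y => (@?f y).2) _ =>
      notypeclasses refine (@is_diff_snd _ _ _ _ f _ _ _); diff_rules
  | |- is_diff_def _ (fun y => (@?f y, @?g y)) _ =>
      notypeclasses refine (@is_diff_pair _ _ _ _ f _ g _ _ _ _); diff_rules
  | |- is_diff_def _ (fun=> _) _ => exact: is_diff_cstf
  | |- _ => idtac
  end.

Section RationalDifferentials.
Set Implicit Arguments.
Unset Strict Implicit.
Variable K : numFieldType.

Section Hamiltonian.
Variables k0 k1 rh : K.

Definition dpH (t q p : K) : K :=
  (2 * q * (q - 1) ^+ 2 * p
   - (k0 * (q - 1) ^+ 2 + (k1 - 1) * q * (q - 1) - t * q)) / t.

Definition dqH (t q p : K) : K :=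
  ((q - 1) * (3 * q - 1) * p ^+ 2
   - (2 * k0 * (q - 1) + (k1 - 1) * (2 * q - 1) - t) * p + rh) / t.

(** [dqH] and [dpH] are the partials in q and p. Since tH is affine in t with slope qp, the partial
    in t is (qp - H)/t. *)
Lemma is_diff_hamiltonian (t q p : K) : t != 0 ->
  let H (x : K * K * K) :=
    (x.1.2 * (x.1.2 - 1) ^+ 2 * x.2 ^+ 2
     - (k0 * (x.1.2 - 1) ^+ 2 + (k1 - 1) * x.1.2 * (x.1.2 - 1)
        - x.1.1 * x.1.2) * x.2
     + rh * (x.1.2 - 1)) / x.1.1 in
  is_diff (t, q, p) H
    (fun v => dqH t q p * v.1.2 + dpH t q p * v.2
              + (q * p - H (t, q, p)) / t * v.1.1).
Proof.
(* The differential stays an existential variable, which [diff_rules] fills in; [field] then matches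
   it with the closed form. *)
move=> t0 H; rewrite {1}/H; eapply is_diff_eq; first by diff_rules.
by apply/funext => v; rewrite /dqH /dpH /H /=; field.
Qed.

(** The continuation of -(q-1) X^V across r = 0, q = 0 and q = 1, where the change of coordinates
    degenerates. *)
Definition chart_XV (y : K * K * K) : K * K * K :=
  let r := y.1.1 in let q := y.1.2 in let P := y.2 in
  let B := k0 * (q - 1) ^+ 2 + (k1 - 1) * q * (q - 1) in
  ((q - 1) * r * (2 * P + 1 - B * r + q * r),
   - q * (q - 1) * (2 * P + 1 - B * r),
   - (q + 1) * P * (P + 1)
   + (q - 1) * q * r * (k1 * P + rh * (q - 1) ^+ 2 * q * r)).

Lemma continuous_chart_XV (y : K * K * K) :
  {for y, continuous chart_XV}.
Proof.
eapply (@is_diff_continuous K (K * K * K)%type (K * K * K)%type).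
by rewrite /chart_XV; cbv zeta; diff_rules.
Qed.

End Hamiltonian.

Lemma is_diff_chart (t q p : K) : t != 0 -> q != 0 ->
  is_diff (t, q, p)
    (fun x : K * K * K =>
       ((x.1.2 * x.1.1)^-1, x.1.2, x.2 * (x.1.2 - 1) ^+ 2 / x.1.1))
    (fun v => (- (q * v.1.1 + t * v.1.2) / (q * t) ^+ 2, v.1.2,
       (v.2 * (q - 1) ^+ 2 + 2 * p * (q - 1) * v.1.2) / t
       - p * (q - 1) ^+ 2 / t ^+ 2 * v.1.1)).
Proof.
move=> t0 q0; eapply is_diff_eq; first by diff_rules; rewrite ?mulf_neq0.
by apply/funext => v /=; congr (_, _, _); field; rewrite ?t0 ?q0.
Qed.

Lemma is_diff_integral (q P : K) : q != 1 ->
  is_diff (q, P)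
    (fun z : K * K => z.1 * z.2 * (z.2 + 1) / (z.1 - 1) ^+ 2)
    (fun v => (- (q + 1) * P * (P + 1) / (q - 1) ^+ 3 * v.1
               + q * (2 * P + 1) / (q - 1) ^+ 2 * v.2)).
Proof.
rewrite -subr_eq0 => q1; eapply is_diff_eq.
  by diff_rules; rewrite expf_neq0.
by apply/funext => v /=; field.
Qed.

End RationalDifferentials.

Section PainleveV.
Set Implicit Arguments.
Unset Strict Implicit.
Variable R : realType.
Local Notation C := (Cplx R).
Variables k0 k1 koo : C.

Lemma XVE (t q p : C) : t != 0 -> XV k0 k1 koo (t, q, p) =
  (1, dpH k0 k1 t q p, - dqH k0 k1 (rho k0 k1 koo) t q p).
Proof.
move=> t0.
have dH := is_diff_hamiltonian k0 k1 (rho k0 k1 koo) q p t0.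
rewrite /XV; congr (_, _, - _).
  by rewrite (is_diff_derive _ dH) /= !mulr0 mulr1 add0r addr0.
by rewrite (is_diff_derive _ dH) /= !mulr0 mulr1 !addr0.
Qed.

Lemma in_chart_XVE (y : C * C * C) : chart_domain y ->
  - (y.1.2 - 1) *: in_chart (XV k0 k1 koo) y
  = chart_XV k0 k1 (rho k0 k1 koo) y.
Proof.
case: y => [[r q] P] [/= r0 q0 q1].
have q10 : q - 1 != 0 by rewrite subr_eq0.
have t0 : (q * r)^-1 != 0 by rewrite invr_neq0// mulf_neq0.
rewrite /in_chart /lie_derivative /of_chart /= XVE//.
rewrite (is_diff_derive _ (is_diff_chart _ t0 q0)) /=.
rewrite /chart_XV /dpH /dqH; congr (_, _, _) => /=.
(* Each component of the scaling is exposed as a product in the field, which [field] recognises. *)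
all: rewrite -[LHS]/(_ * _).
all: field; rewrite ?r0 ?q0 ?q10//.
Qed.

End PainleveV.

Theorem proposition2p9 (R : realType) (k0 k1 koo : Cplx R) :
  restricts_to
    (fun y : Cplx R * Cplx R * Cplx R =>
       - (y.1.2 - 1) *: in_chart (XV k0 k1 koo) y)
    (@XV_Aoo R) /\
  first_integral [set z : Cplx R * Cplx R | z.1 != 1]
    (@XV_Aoo R) (@integral_Aoo R).
Proof.
split=> [q P|].
  have -> : (0, (XV_Aoo (q, P)).1, (XV_Aoo (q, P)).2)
      = chart_XV k0 k1 (rho k0 k1 koo) (0, q, P).
    by rewrite /chart_XV /XV_Aoo /=; congr (_, _, _); ring.
  have := @continuous_chart_XV _ k0 k1 (rho k0 k1 koo) (0, q, P).
  move=> /(@cvg_within_filter _ _ _ _ _ _ (@chart_domain R)).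
  (* The limit is taken within [chart_domain], where the field coincides with the continuous
     [chart_XV]. *)
  apply: cvg_trans; apply: near_eq_cvg.
  by apply: filterS (withinT _ _) => y yD; rewrite in_chart_XVE.
split=> [[q P] q1|[q P] q1|].
- by have [] := is_diff_integral P q1.
- rewrite /lie_derivative.
  rewrite (is_diff_derive _ (is_diff_integral P q1)) /=.
  (* The two terms are opposite: q(q+1)P(P+1)(2P+1)/(q-1)^2 and its negative. *)
  by field; rewrite subr_eq0.
(* At q = 2 the denominator is 1; the values at P = 0 and P = 1 are 0 and 4. *)
- exists (2, 0), (2, 1); rewrite /integral_Aoo /=.
  have two1 : (2 : Cplx R) != 1 by rewrite (eqr_nat _ 2 1).
  split=> //; rewrite mulr0 !mul0r => /esym/eqP.
  by rewrite (_ : 2 - 1 = 1) ?expr1n ?invr1 ?mulr1 ?mulf_eq0 ?pnatr_eq0//; ring.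
Qed.
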